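(* Let $\alpha=(\alpha_1,\dots,\alpha_l)\vDash_e n$ be a maximal composition, let $\sigma\in\mathfrak S_n$ be of type $\alpha$ (i.e. the multiset of cycle lengths of $\sigma$, including trivial cycles, is the multiset of parts of $\alpha$), and let $0\le j\le l$ be such that $\alpha':=(\alpha_{j+1},\dots,\alpha_l)$ are the odd parts of $\alpha$ (so that $\alpha_1,\dots,\alpha_j$ are even). Then $\sigma\in\Sigma_\alpha$ if and only if there are $\sigma_i\in\Sigma_{(\alpha_i)}$ for $i=1,\dots,j$ and $\tau\in\Sigma_{\alpha'}$ such that $$\sigma=\sigma_1\odot\sigma_2\odot\cdots\odot\sigma_j\odot\tau,$$ where the product is evaluated from right to left.
   Context: $[a]=\{1,\dots,a\}$. $\mathfrak S_n$ is the symmetric group on $[n]$ (products are compositions of functions), with Coxeter generators $s_i=(i,i+1)$ and Coxeter length function $\ell$ (number of inversions). $\mathfrak S_0$ is the trivial group consisting of the empty function. Relation $\approx$: write $w\overset{s_i}{\to}w'$ if $w'=s_iws_i$ and $\ell(w')\le\ell(w)$. Let $\to$ be the reflexive and transitive closure of the union of the relations $\overset{s_i}{\to}$, $1\le i\le n-1$. Write $w\approx w'$ if $w\to w'$ and $w'\to w$; this is an equivalence relation on $\mathfrak S_n$. A composition $\alpha=(\alpha_1,\dots,\alpha_l)$ of $n$ (finite sequence of positive integers with sum $n$) is maximal, written $\alpha\vDash_e n$, if there is $0\le k\le l$ such that $\alpha_i$ is even for $i\le k$, $\alpha_i$ is odd for $i>k$, and $\alpha_{k+1}\ge\dots\ge\alpha_l$.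 Element in stair form: let $(x_1,\dots,x_n)$ be the list with $x_{2i-1}=i$ and $x_{2i}=n-i+1$. For a composition $\alpha=(\alpha_1,\dots,\alpha_l)$ of $n$, $\sigma_\alpha\in\mathfrak S_n$ is the product of the disjoint cycles $(x_{\alpha_1+\dots+\alpha_{i-1}+1},\dots,x_{\alpha_1+\dots+\alpha_{i-1}+\alpha_i})$, $i=1,\dots,l$. For $\alpha\vDash_e n$, $\Sigma_\alpha\subseteq\mathfrak S_n$ is the $\approx$-equivalence class of $\sigma_\alpha$. For the empty composition, $\Sigma_\emptyset=\mathfrak S_0$. Inductive product: let $n_1,n_2\ge0$ and $k=\lceil n_1/2\rceil$. For $\sigma_1\in\mathfrak S_{n_1}$, $\sigma_2\in\mathfrak S_{n_2}$, $\sigma_1\odot\sigma_2\in\mathfrak S_{n_1+n_2}$ is the permutation whose cycles (including trivial ones) are the cycles of $\sigma_1$ with $n_2$ added to each entry $>k$, together with the cycles of $\sigma_2$ with $k$ added to each entry. *)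

(* Defs.v *)
From mathcomp Require Import all_boot all_fingroup.

Set Implicit Arguments.
Unset Strict Implicit.
Unset Printing Implicit Defensive.

(* The set [n] is encoded as 'I_n, so all entries are shifted down by one.   *)

(* The cyclic permutation (c_1, ..., c_k), mapping c_i to c_(i+1) and c_k to *)
(* c_1. It is only used on duplicate-free lists, for which undup c = c.      *)
Definition cycle_perm (T : finType) (c : seq T) : {perm T} :=
  perm (can_inj (prev_next (undup_uniq c))).

Definition perm_of_cycles (T : finType) (cs : seq (seq T)) : {perm T} :=
  (\prod_(c <- cs) cycle_perm c)%g.

(* Trivial cycles are included. *)
Definition cycles (T : finType) (s : {perm T}) : seq (seq T) :=
  [seq fingraph.orbit s x | x <- enum (froots s)].

Definition cycle_type (T : finType) (s : {perm T}) : seq nat :=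
  [seq size c | c <- cycles s].

Definition coxeter_length n (w : 'S_n) : nat :=
  #|[set p : 'I_n * 'I_n | (p.1 < p.2) && (w p.2 < w p.1)]|.

Definition coxeter_step n : rel 'S_n := fun w w' =>
  [exists i : 'I_n, exists j : 'I_n,
    [&& j == i.+1 :> nat,
        w' == (tperm i j * w * tperm i j)%g
      & coxeter_length w' <= coxeter_length w]].

Definition coxeter_equiv n : rel 'S_n := fun w w' =>
  connect (@coxeter_step n) w w' && connect (@coxeter_step n) w' w.

Definition composition (n : nat) (alpha : seq nat) : Prop :=
  all (leq 1) alpha /\ sumn alpha = n.

Definition maximal_composition (n : nat) (alpha : seq nat) : Prop :=
  composition n alpha /\
  exists k : nat, [/\ k <= size alpha,
                      all (fun a => ~~ odd a) (take k alpha),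
                      all odd (drop k alpha)
                    & sorted geq (drop k alpha)].

(* With 0-based positions and values, x_(2i-1) = i reads "p |-> p / 2" for   *)
(* even p = 2i-2, and x_(2i) = n-i+1 reads "p |-> n - (p+1) / 2" for odd     *)
(* p = 2i-1.                                                                 *)
Definition stair_val (n p : nat) : nat := if odd p then n - uphalf p else p./2.

Lemma stair_val_lt n (p : 'I_n) : stair_val n p < n.
Proof.
rewrite /stair_val; case: p => p /= ltpn; case: ifP => odd_p.
  by case: p odd_p ltpn => [|p] //= _ ltpn; rewrite ltn_subrL /= (leq_ltn_trans _ ltpn).
by rewrite (leq_ltn_trans _ ltpn) // -divn2 leq_div.
Qed.

Definition stair_list n : seq 'I_n :=
  [seq Ordinal (stair_val_lt p) | p <- enum 'I_n].

(* Meaningful when alpha is a composition of n: the list (x_1, ..., x_n) is  *)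
(* then cut into consecutive blocks of lengths alpha_1, ..., alpha_l.        *)
Definition stair_perm n (alpha : seq nat) : 'S_n :=
  perm_of_cycles (reshape alpha (stair_list n)).

Definition Sigma n (alpha : seq nat) : {set 'S_n} :=
  [set w | coxeter_equiv (stair_perm n alpha) w].

Lemma iprod_shiftl_lt n1 n2 (i : 'I_n1) :
  (if i < uphalf n1 then i : nat else i + n2) < n1 + n2.
Proof.
by case: ifP => _; rewrite ?ltn_add2r // (leq_trans (ltn_ord i)) ?leq_addr.
Qed.

Lemma iprod_shiftr_lt n1 n2 (i : 'I_n2) : i + uphalf n1 < n1 + n2.
Proof.
rewrite addnC -addnS leq_add //.
by rewrite leq_uphalf_double -addnn leq_addr.
Qed.

Definition iprod_shiftl n1 n2 (i : 'I_n1) : 'I_(n1 + n2) :=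
  Ordinal (iprod_shiftl_lt n2 i).

Definition iprod_shiftr n1 n2 (i : 'I_n2) : 'I_(n1 + n2) :=
  Ordinal (iprod_shiftr_lt n1 i).

Definition iprod n1 n2 (s1 : 'S_n1) (s2 : 'S_n2) : 'S_(n1 + n2) :=
  perm_of_cycles
    (map (map (@iprod_shiftl n1 n2)) (cycles s1) ++
     map (map (@iprod_shiftr n1 n2)) (cycles s2)).

(* Permutations bundled with their degree, so that iterated inductive        *)
(* products need no casts between the degrees.                               *)
Definition sized_perm : Type := {n : nat & 'S_n}.

Definition sized n (s : 'S_n) : sized_perm := existT (fun m => 'S_m) n s.

Definition sized_iprod (u v : sized_perm) : sized_perm :=
  sized (iprod (tagged u) (tagged v)).

(* Main.v *)
(* For even a, the stair form of a :: alpha is the inductive product of the stair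
   forms of (a) and alpha, and the first factor is oscillating: it exchanges the
   two halves of its domain. A product w of an oscillating permutation and any
   other one has, at each border between outer and inner positions, a descent in
   both w and w^-1, so conjugating there either shortens w or fixes it. Hence
   length-preserving conjugations of w by simple reflections act on the two
   factors separately, and the class of the product is the product of the
   classes. *)

Require Import Defs.
From mathcomp Require Import all_boot all_fingroup.
From mathcomp Require Import zify.

Set Implicit Arguments.
Unset Strict Implicit.
Unset Printing Implicit Defensive.

Local Open Scope group_scope.

(** * Products of cycles and recovery of a permutation from its cycles *)

Section PermOfCycles.

Variable T : finType.
Implicit Types (c : seq T) (cs : seq (seq T)) (s : {perm T}) (x : T).

Lemma cycle_permE c x : cycle_perm c x = next (undup c) x.
Proof. by rewrite permE. Qed.

Lemma cycle_perm_out c x : x \notin c -> cycle_perm c x = x.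
Proof. by move=> xNc; rewrite cycle_permE next_nth mem_undup (negPf xNc). Qed.

Lemma perm_of_cycles_cons c cs :
  perm_of_cycles (c :: cs) = cycle_perm c * perm_of_cycles cs.
Proof. by rewrite /perm_of_cycles big_cons. Qed.

Lemma perm_of_cycles_cat cs1 cs2 :
  perm_of_cycles (cs1 ++ cs2) = perm_of_cycles cs1 * perm_of_cycles cs2.
Proof. by rewrite /perm_of_cycles big_cat. Qed.

Lemma perm_of_cycles_out cs x :
  all (fun c => x \notin c) cs -> perm_of_cycles cs x = x.
Proof.
elim: cs => [_|c cs IH /andP[xNc /IH eq_x]].
  by rewrite /perm_of_cycles big_nil perm1.
by rewrite perm_of_cycles_cons permM cycle_perm_out.
Qed.

Lemma cycle_perm_orbit s r x :
  r \in froots s ->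
  cycle_perm (fingraph.orbit s r) x = if froot s x == r then s x else x.
Proof.
move=> root_r; have fs := fconnect_sym (@perm_inj _ s).
have memE : (x \in fingraph.orbit s r) = (froot s x == r).
  by rewrite -fconnect_orbit fs -(root_connect fs) (eqP root_r).
rewrite -memE; case: ifPn => [x_r|]; last exact: cycle_perm_out.
rewrite cycle_permE (undup_id (orbit_uniq _ _)).
by rewrite -(eqP (next_cycle (cycle_orbit (@perm_inj _ s) r) x_r)).
Qed.

Lemma perm_of_cyclesK s : perm_of_cycles (cycles s) = s.
Proof.
have fs := fconnect_sym (@perm_inj _ s).
(* Generalized to partial products for the induction: the cycles through the roots in [rs] act as
   [s] on their own orbits and fix every other point. *)
suff orbE (rs : seq T) x : uniq rs -> {subset rs <= froots s} ->
    perm_of_cycles [seq fingraph.orbit s r | r <- rs] x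
      = if froot s x \in rs then s x else x.
  apply/permP=> x; rewrite orbE ?enum_uniq //.
    by rewrite mem_enum (_ : _ \in _ = true) //; apply: roots_root.
  by move=> r; rewrite mem_enum.
elim: rs x => [|r rs IH] x /=; first by rewrite /perm_of_cycles big_nil perm1.
case/andP=> rNrs uniq_rs sub_rs.
rewrite perm_of_cycles_cons permM IH //; last first.
  by move=> y y_rs; apply: sub_rs; rewrite inE y_rs orbT.
rewrite cycle_perm_orbit ?sub_rs ?mem_head // inE.
have [eq_r|] := eqVneq; last by [].
have -> : froot s (s x) = froot s x.
  by apply/eqP; rewrite (root_connect fs) fs fconnect1.
by rewrite eq_r (negPf rNrs).
Qed.

End PermOfCycles.

Lemma perm_of_cycles_map (T U : finType) (f : T -> U) (cs : seq (seq T)) x :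
  injective f ->
  perm_of_cycles (map (map f) cs) (f x) = f (perm_of_cycles cs x).
Proof.
move=> inj_f; elim: cs x => [|c cs IH] x /=.
  by rewrite /perm_of_cycles !big_nil !perm1.
rewrite !perm_of_cycles_cons !permM -IH; congr (perm_of_cycles _ _).
by rewrite !cycle_permE undup_map_inj // next_map // undup_uniq.
Qed.

Lemma perm_of_cycles_map_out (T U : finType) (f : T -> U) (cs : seq (seq T)) y :
  (forall x, f x != y) -> perm_of_cycles (map (map f) cs) y = y.
Proof.
move=> fNy; apply: perm_of_cycles_out; apply/allP=> _ /mapP[c _ ->].
by apply/negP=> /mapP[x _ eq_y]; case/eqP: (fNy x).
Qed.

(** * Length under multiplication and conjugation by simple reflections *)

Section CoxeterLength.

Variable n : nat.
Implicit Types (w : 'S_n) (i j : 'I_n).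

Lemma coxeter_lengthV w : coxeter_length w^-1 = coxeter_length w.
Proof.
have inj : injective (fun p : 'I_n * 'I_n => (w p.2, w p.1)).
  by move=> [p q] [p' q'] /= [/perm_inj-> /perm_inj->].
rewrite /coxeter_length -[in RHS](card_imset _ inj); apply: eq_card => -[p q].
rewrite inE /=; apply/andP/imsetP => [[ltpq ltqp]|[[p' q']]].
  by exists (w^-1 q, w^-1 p); rewrite ?inE /= ?permKV ?ltqp.
by rewrite inE /= => /andP[lt lt'] [-> ->]; rewrite !permK.
Qed.

(** No value lies strictly between [i] and [j], so swapping them can only affect the comparison of
    [i] with [j] itself. *)
Lemma ltn_tperm_succ i j (p q : 'I_n) : j = i.+1 :> nat -> p < q ->
  (p, q) != (i, j) -> tperm i j p < tperm i j q.
Proof.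
have tE (x : 'I_n) : tperm i j x =
    (if x == i :> nat then j else if x == j :> nat then i else x) :> nat.
  by rewrite !(inj_eq val_inj) permE /=; case: ifP => // _; case: ifP.
move=> eq_j lt_pq; rewrite xpair_eqE -!(inj_eq val_inj) /= !tE.
by do ![case: eqP => ? /=]; lia.
Qed.

(** Applying [tperm i j] to both positions of a pair turns the inversions of [w] into those of
    [tperm i j * w], except that [(i, j)] is a new one. *)
Lemma coxeter_length_tpermL i j w : j = i.+1 :> nat -> w i < w j ->
  coxeter_length (tperm i j * w) = (coxeter_length w).+1.
Proof.
move=> eq_j lt_w.
pose f (p : 'I_n * 'I_n) := (tperm i j p.1, tperm i j p.2).
have fK : involutive f by case=> p q; rewrite /f /= !tpermK.
pose I := [set p : 'I_n * 'I_n | (p.1 < p.2) && (w p.2 < w p.1)].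
have memfI p : (p \in f @: I) = (f p \in I).
  by rewrite -{1}[p]fK mem_imset //; apply: inv_inj fK.
have ijNI : (i, j) \notin f @: I.
  by rewrite memfI inE /= tpermL tpermR; lia.
transitivity #|(i, j) |: f @: I|; last first.
  by rewrite cardsU1 ijNI (card_imset _ (inv_inj fK)).
apply: eq_card => -[p q]; rewrite in_setU1 memfI !inE /= !permM.
have [[-> ->]|pqNij] := eqVneq (p, q) (i, j).
  by rewrite tpermL tpermR lt_w; lia.
have [lt_pq|le_qp] := ltnP p q; first by rewrite ltn_tperm_succ.
apply/esym/negP=> /andP[lt_t lt_wt].
have [eqt|tNij] := eqVneq (tperm i j p, tperm i j q) (i, j).
  by case: eqt lt_wt => -> ->; lia.
by have := ltn_tperm_succ eq_j lt_t tNij; rewrite !tpermK; lia.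
Qed.

(** The two cases, length up by 1 and length down by 1, are merged into one equation free of
    subtraction, which suits [lia]. The second case is the first one applied to [tperm i j * w]. *)
Lemma coxeter_length_tperm i j w : j = i.+1 :> nat ->
  coxeter_length w + (w i < w j) =
    coxeter_length (tperm i j * w) + ~~ (w i < w j).
Proof.
move=> eq_j; case: ltnP => [lt_w|ge_w] /=.
  by rewrite (coxeter_length_tpermL eq_j lt_w); lia.
have wNij : w i != w j.
  by rewrite (inj_eq perm_inj) -(inj_eq val_inj) /= eq_j; lia.
have lt_sw : (tperm i j * w)%g i < (tperm i j * w)%g j.
  by rewrite !permM tpermL tpermR ltn_neqAle eq_sym wNij.
by have := coxeter_length_tpermL eq_j lt_sw; rewrite tpermKg; lia.
Qed.

(* Left and right multiplication by tperm i j change the length by 1 each, up or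
   down according to a comparison of values of w and of w^-1. The left one leaves
   the second comparison unchanged unless w preserves {i, j}, in which case
   conjugation fixes w. *)
Lemma coxeter_length_conj i j w : j = i.+1 :> nat ->
  (coxeter_length (tperm i j * w * tperm i j) == coxeter_length w) =
    (tperm i j * w * tperm i j == w) || ((w i < w j) != (w^-1%g i < w^-1%g j)).
Proof.
move=> eq_j; have [->|sws_neq] := eqVneq (tperm i j * w * tperm i j)%g w.
  by rewrite eqxx.
have := coxeter_length_tperm w eq_j.
(* Inversion preserves length and turns right multiplication into left multiplication, so
   [coxeter_length_tperm] covers both factors. *)
have -> : coxeter_length (tperm i j * w * tperm i j) =
    coxeter_length (tperm i j * (w^-1 * tperm i j)).
  by rewrite -coxeter_lengthV !invMg tpermV.
have := coxeter_length_tperm (w^-1 * tperm i j) eq_j.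
have -> : coxeter_length (w^-1 * tperm i j) = coxeter_length (tperm i j * w).
  by rewrite -coxeter_lengthV invMg tpermV invgK.
rewrite !permM.
suff -> : (tperm i j (w^-1%g i) < tperm i j (w^-1%g j)) = (w^-1%g i < w^-1%g j).
  by case: (w i < w j); case: (w^-1%g i < w^-1%g j) => /=; lia.
have sws_id : (w i = i /\ w j = j) \/ (w i = j /\ w j = i) -> False.
  move=> wij; case/eqP: sws_neq; apply/permP=> x; rewrite !permM.
  by case: wij => -[wi wj]; case: (tpermP i j x) => [->|->|/eqP xNi /eqP xNj];
    rewrite ?wi ?wj ?tpermL ?tpermR // tpermD //;
    (rewrite -[X in X != _]wi || rewrite -[X in X != _]wj);
    rewrite (inj_eq perm_inj) eq_sym.
have [lt_w|le_w] := ltnP (w^-1%g i) (w^-1%g j).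
  apply: ltn_tperm_succ => //; apply/eqP=> -[ei ej]; apply: sws_id; left.
  by split; [rewrite -{1}ei permKV|rewrite -{1}ej permKV].
apply/negbTE; rewrite -leqNgt leq_eqVlt ltn_tperm_succ ?orbT //.
  by rewrite ltn_neqAle le_w andbT (inj_eq val_inj)
             (inj_eq perm_inj) -(inj_eq val_inj) /= eq_j; lia.
apply/eqP=> -[ei ej]; apply: sws_id; right.
by split; [rewrite -{1}ei permKV|rewrite -{1}ej permKV].
Qed.

End CoxeterLength.

(** * The equivalence relation and its induction principle *)

Section CoxeterEquiv.

Variable n : nat.
Implicit Types (w : 'S_n) (i j : 'I_n).

Lemma coxeter_equiv_refl w : coxeter_equiv w w.
Proof. by rewrite /coxeter_equiv connect0. Qed.

Lemma coxeter_equiv_trans : transitive (@coxeter_equiv n).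
Proof.
move=> w2 w1 w3 /andP[w12 w21] /andP[w23 w32].
by rewrite /coxeter_equiv (connect_trans w12 w23) (connect_trans w32 w21).
Qed.

Lemma coxeter_equiv_conj i j w : j = i.+1 :> nat ->
  coxeter_length (tperm i j * w * tperm i j) = coxeter_length w ->
  coxeter_equiv w (tperm i j * w * tperm i j).
Proof.
move=> eq_j eq_len; apply/andP; split; apply: connect1.
  by apply/existsP; exists i; apply/existsP; exists j; rewrite eq_j eq_len !eqxx /=.
apply/existsP; exists i; apply/existsP; exists j; rewrite eq_j eq_len !eqxx /=.
by rewrite leqnn andbT -!mulgA tperm2 mulg1 mulgA tperm2 mul1g.
Qed.

Lemma connect_coxeter_length w w' :
  connect (@coxeter_step n) w w' -> coxeter_length w' <= coxeter_length w.
Proof.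
case/connectP=> p; elim: p w => [|v p IH] w /=; first by move=> _ ->.
case/andP=> /existsP[i /existsP[j /and3P[_ _ le_vw]]] path_p eq_w'.
exact: leq_trans (IH _ path_p eq_w') le_vw.
Qed.

(** Length never increases along a path, and the path back from [w'] to [w] shows that it does not
    drop overall. Hence every step from [w] to [w'] preserves length. *)
Lemma coxeter_equiv_ind (P : 'S_n -> Prop) :
  (forall w i j, j = i.+1 :> nat ->
     coxeter_length (tperm i j * w * tperm i j) = coxeter_length w ->
     P w -> P (tperm i j * w * tperm i j)) ->
  forall w w', coxeter_equiv w w' -> P w -> P w'.
Proof.
move=> stepP w w' /andP[/connectP[p path_p eq_w'] /connect_coxeter_length].
elim: p w path_p eq_w' => [|v p IH] w /=; first by move=> _ ->.
case/andP=> step_wv path_p eq_w' le_ww' Pw.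
have le_w'v : coxeter_length w' <= coxeter_length v.
  by apply: connect_coxeter_length; apply/connectP; exists p.
case/existsP: step_wv => i /existsP[j /and3P[/eqP eq_j /eqP eq_v le_vw]].
apply: (IH v) => //; first exact: leq_trans le_vw le_ww'.
rewrite eq_v; apply: stepP => //; rewrite -eq_v.
by apply/eqP; rewrite eqn_leq le_vw (leq_trans le_ww' le_w'v).
Qed.

End CoxeterEquiv.

(** * The inductive product as an action on outer and inner positions *)

Section InductiveProduct.

Variables a m : nat.
Implicit Types (s : 'S_a) (t : 'S_m).

Local Notation shiftl := (@iprod_shiftl a m).
Local Notation shiftr := (@iprod_shiftr a m).

Lemma iprod_shiftl_mono (x y : 'I_a) : (shiftl x < shiftl y) = (x < y).
Proof. by rewrite /=; do 2![case: (ltnP _ (uphalf a)) => ?]; lia. Qed.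

Lemma iprod_shiftl_inj : injective shiftl.
Proof.
move=> x y /(congr1 val) /=.
by do 2![case: (ltnP _ (uphalf a)) => ?] => ?; apply: val_inj => /=; lia.
Qed.

Lemma iprod_shiftr_inj : injective shiftr.
Proof. by move=> x y [/addIn eq_xy]; apply: val_inj. Qed.

Lemma iprod_shiftl_neq_shiftr x y : shiftl x != shiftr y.
Proof.
apply/eqP=> /(congr1 val) /=; have := ltn_ord y.
by case: (ltnP _ (uphalf a)) => ?; lia.
Qed.

(** Case analysis on positions: the first factor occupies the outer ones, at both ends, and the
    second factor the block of [m] inner ones. *)
Variant iprod_shift_spec : 'I_(a + m) -> Type :=
  | IprodShiftl x : iprod_shift_spec (shiftl x)
  | IprodShiftr y : iprod_shift_spec (shiftr y).

Lemma iprod_shiftP z : iprod_shift_spec z.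
Proof.
have ltz := ltn_ord z.
have [lt_z|le_z] := ltnP z (uphalf a).
  have lt_za : z < a by lia.
  rewrite (_ : z = shiftl (Ordinal lt_za)); first exact: IprodShiftl.
  by apply: val_inj; rewrite /= lt_z.
have [lt_z|ge_z] := ltnP z (uphalf a + m).
  have lt_zm : z - uphalf a < m by lia.
  rewrite (_ : z = shiftr (Ordinal lt_zm)); first exact: IprodShiftr.
  by apply: val_inj => /=; lia.
have lt_za : z - m < a by lia.
rewrite (_ : z = shiftl (Ordinal lt_za)); first exact: IprodShiftl.
by apply: val_inj => /=; case: (ltnP _ (uphalf a)); lia.
Qed.

Lemma perm_of_cycles_iprodl cs1 cs2 x :
  perm_of_cycles (map (map shiftl) cs1 ++ map (map shiftr) cs2) (shiftl x)
    = shiftl (perm_of_cycles cs1 x).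
Proof.
rewrite perm_of_cycles_cat permM perm_of_cycles_map; last exact: iprod_shiftl_inj.
by apply: perm_of_cycles_map_out => y; rewrite eq_sym iprod_shiftl_neq_shiftr.
Qed.

Lemma perm_of_cycles_iprodr cs1 cs2 y :
  perm_of_cycles (map (map shiftl) cs1 ++ map (map shiftr) cs2) (shiftr y)
    = shiftr (perm_of_cycles cs2 y).
Proof.
rewrite perm_of_cycles_cat permM (perm_of_cycles_map_out (f := shiftl)).
  by rewrite perm_of_cycles_map //; apply: iprod_shiftr_inj.
by move=> x; apply: iprod_shiftl_neq_shiftr.
Qed.

Lemma iprodEl s t x : iprod s t (shiftl x) = shiftl (s x).
Proof. by rewrite /iprod perm_of_cycles_iprodl perm_of_cyclesK. Qed.

Lemma iprodEr s t y : iprod s t (shiftr y) = shiftr (t y).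
Proof. by rewrite /iprod perm_of_cycles_iprodr perm_of_cyclesK. Qed.

(** [iprod] is defined through the orbits listed by [cycles]; here any cycle lists are allowed, so
    that the blocks of a stair form can be used directly. *)
Lemma iprod_perm_of_cycles cs1 cs2 :
  iprod (perm_of_cycles cs1) (perm_of_cycles cs2) =
    perm_of_cycles (map (map shiftl) cs1 ++ map (map shiftr) cs2).
Proof.
apply/permP=> z; case: (iprod_shiftP z) => x.
  by rewrite iprodEl perm_of_cycles_iprodl.
by rewrite iprodEr perm_of_cycles_iprodr.
Qed.

Lemma iprodV s t : (iprod s t)^-1 = iprod s^-1 t^-1.
Proof.
apply/eqP; rewrite eq_invg_mul; apply/eqP/permP=> z; rewrite permM perm1.
by case: (iprod_shiftP z) => x; rewrite !(iprodEl, iprodEr) permK.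
Qed.

Lemma iprod_injl s s' t : iprod s t = iprod s' t -> s = s'.
Proof.
move=> eq_st; apply/permP=> x; apply: iprod_shiftl_inj.
by rewrite -(iprodEl s t) eq_st iprodEl.
Qed.

Lemma iprod_injr s t t' : iprod s t = iprod s t' -> t = t'.
Proof.
move=> eq_st; apply/permP=> x; apply: iprod_shiftr_inj.
by rewrite -(iprodEr s t) eq_st iprodEr.
Qed.

Lemma iprod_conjl i j s t :
  tperm (shiftl i) (shiftl j) * iprod s t * tperm (shiftl i) (shiftl j) =
    iprod (tperm i j * s * tperm i j) t.
Proof.
apply/permP=> z; rewrite !permM; case: (iprod_shiftP z) => x.
  by rewrite iprodEl -inj_tperm ?iprodEl -?inj_tperm ?permM //;
    apply: iprod_shiftl_inj.
by rewrite !(iprodEr, tpermD) ?iprod_shiftl_neq_shiftr.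
Qed.

Lemma iprod_conjr i j s t :
  tperm (shiftr i) (shiftr j) * iprod s t * tperm (shiftr i) (shiftr j) =
    iprod s (tperm i j * t * tperm i j).
Proof.
apply/permP=> z; rewrite !permM; case: (iprod_shiftP z) => x.
  by rewrite !(iprodEl, tpermD) // eq_sym iprod_shiftl_neq_shiftr.
by rewrite iprodEr -inj_tperm ?iprodEr -?inj_tperm ?permM //;
  apply: iprod_shiftr_inj.
Qed.

(** By [coxeter_length_conj], the answer depends on two comparisons and on whether conjugation fixes
    the permutation. [shiftl] is increasing and [iprod] injective in [s], so all of this carries
    over. The second hypothesis excludes a pair separated by the inner block. *)
Lemma coxeter_length_iprod_conjl (i j : 'I_a) s t :
  j = i.+1 :> nat -> shiftl j = (shiftl i).+1 :> nat ->
  (coxeter_length (iprod (tperm i j * s * tperm i j) t) ==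
     coxeter_length (iprod s t)) =
  (coxeter_length (tperm i j * s * tperm i j) == coxeter_length s).
Proof.
move=> eq_j eq_sj; rewrite -iprod_conjl !coxeter_length_conj // iprodV.
rewrite !iprodEl !iprod_shiftl_mono iprod_conjl; congr (_ || _).
by apply/eqP/eqP=> [/iprod_injl//|->].
Qed.

Lemma coxeter_length_iprod_conjr (i j : 'I_m) s t : j = i.+1 :> nat ->
  (coxeter_length (iprod s (tperm i j * t * tperm i j)) ==
     coxeter_length (iprod s t)) =
  (coxeter_length (tperm i j * t * tperm i j) == coxeter_length t).
Proof.
move=> eq_j; have eq_sj : shiftr j = (shiftr i).+1 :> nat by rewrite /= eq_j.
rewrite -iprod_conjr !coxeter_length_conj // iprodV.
rewrite !iprodEr /= !ltn_add2r iprod_conjr; congr (_ || _).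
by apply/eqP/eqP=> [/iprod_injr//|->].
Qed.

End InductiveProduct.

(** * Permutations exchanging the two halves *)

Section Oscillating.

Variable a : nat.
Implicit Types (s : 'S_a) (i j : 'I_a).

Definition oscillating s := forall i, (s i < uphalf a) = (uphalf a <= i).

Lemma oscillatingV s : oscillating s -> oscillating s^-1.
Proof. by move=> osc_s i; have := osc_s (s^-1%g i); rewrite permKV; lia. Qed.

(* Both s and s^-1 have a descent at the middle, so conjugating there either
   shortens s or fixes it. *)
Lemma oscillating_conj_mid i j s :
  j = i.+1 :> nat -> j = uphalf a :> nat -> oscillating s ->
  coxeter_length (tperm i j * s * tperm i j) = coxeter_length s ->
  tperm i j * s * tperm i j = s.
Proof.
move=> eq_j eq_mid osc_s /eqP; rewrite coxeter_length_conj //.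
case/orP=> [/eqP //|].
have := osc_s i; have := osc_s j.
by have := oscillatingV osc_s i; have := oscillatingV osc_s j; lia.
Qed.

(** Away from the middle, [tperm i j] maps each half to itself; at the middle, the conjugation is
    trivial by [oscillating_conj_mid]. *)
Lemma oscillating_conj i j s :
  j = i.+1 :> nat -> oscillating s ->
  coxeter_length (tperm i j * s * tperm i j) = coxeter_length s ->
  oscillating (tperm i j * s * tperm i j).
Proof.
move=> eq_j osc_s eq_len.
have [mid|mid] := eqVneq (j : nat) (uphalf a).
  by rewrite (oscillating_conj_mid eq_j mid).
have side x : (tperm i j x < uphalf a) = (x < uphalf a).
  by case: tpermP => [->|->|//]; rewrite eq_j in mid *; lia.
move=> x; rewrite !permM side osc_s.
by rewrite leqNgt side -leqNgt.
Qed.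

End Oscillating.

(** * The class of a product with an oscillating first factor *)

Section EvenInductiveProduct.

Variables (a m : nat).
Implicit Types (s : 'S_a) (t : 'S_m).

Local Notation shiftl := (@iprod_shiftl a m).
Local Notation shiftr := (@iprod_shiftr a m).

(** A step of [s] at the middle may not lift to a simple reflection, as the inner block comes
    between the two positions, but such a step is trivial. All other steps lift. Oscillation is
    carried through the induction for this purpose. *)
Lemma iprod_equivl s s' t : oscillating s ->
  coxeter_equiv s s' -> coxeter_equiv (iprod s t) (iprod s' t).
Proof.
move=> osc_s equiv_s.
suff [] : oscillating s' /\ coxeter_equiv (iprod s t) (iprod s' t) by [].
move: equiv_s (conj osc_s (coxeter_equiv_refl (iprod s t))).
apply: (coxeter_equiv_ind
  (P := fun v => oscillating v /\ coxeter_equiv (iprod s t) (iprod v t))).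
move=> v i j eq_j eq_len [osc_v equiv_v]; split; first exact: oscillating_conj.
have [mid|mid] := eqVneq (j : nat) (uphalf a).
  by rewrite (oscillating_conj_mid eq_j mid).
apply: coxeter_equiv_trans equiv_v _; rewrite -iprod_conjl.
have eq_sj : shiftl j = (shiftl i).+1 :> nat.
  by move/eqP: mid; rewrite /= eq_j; do 2![case: (ltnP _ (uphalf a)) => ?]; lia.
apply: coxeter_equiv_conj => //; rewrite iprod_conjl; apply/eqP.
by rewrite coxeter_length_iprod_conjl // eq_len.
Qed.

Lemma iprod_equivr s t t' :
  coxeter_equiv t t' -> coxeter_equiv (iprod s t) (iprod s t').
Proof.
move=> equiv_t; move: equiv_t (coxeter_equiv_refl (iprod s t)).
apply: (coxeter_equiv_ind (P := fun v => coxeter_equiv _ (iprod s v) : Prop)).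
move=> v i j eq_j eq_len equiv_v.
apply: coxeter_equiv_trans equiv_v _; rewrite -iprod_conjr.
apply: coxeter_equiv_conj; first by rewrite /= eq_j.
by rewrite iprod_conjr; apply/eqP; rewrite coxeter_length_iprod_conjr // eq_len.
Qed.

(* Where a position of s is adjacent to a position of t, both the product and its
   inverse have a descent because s is oscillating, so a length-preserving
   conjugation there is trivial. *)
Lemma oscillating_iprod_conj (i j : 'I_(a + m)) s t : ~~ odd a ->
  j = i.+1 :> nat -> oscillating s ->
  let w' := tperm i j * iprod s t * tperm i j in
  coxeter_length w' = coxeter_length (iprod s t) ->
  exists s' t', [/\ oscillating s', coxeter_equiv s s', coxeter_equiv t t'
                  & w' = iprod s' t'].
Proof.
move=> even_a + osc_s; have osc_sV := oscillatingV osc_s.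
have trivial_step w : w = iprod s t -> exists s' t',
    [/\ oscillating s', coxeter_equiv s s', coxeter_equiv t t' & w = iprod s' t'].
  by move=> ->; exists s, t; split=> //; apply: coxeter_equiv_refl.
case: (iprod_shiftP i) => x; case: (iprod_shiftP j) => y eq_ij /=.
- rewrite iprod_conjl => eq_len.
  (* Outer positions on different sides of the inner block can be adjacent in the product only if
     [m = 0], and then they are also adjacent in ['I_a]. *)
  have eq_y : y = x.+1 :> nat.
    move: eq_ij => /=; have := ltn_ord x; have := ltn_ord y.
    by do 2![case: (ltnP _ (uphalf a)) => ?]; lia.
  move/eqP: eq_len; rewrite coxeter_length_iprod_conjl // => /eqP eq_len.
  exists (tperm x y * s * tperm x y), t; split=> //.
  + exact: oscillating_conj.
  + exact: coxeter_equiv_conj.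
  + exact: coxeter_equiv_refl.
- move/eqP; rewrite coxeter_length_conj // iprodV !(iprodEl, iprodEr).
  case/orP=> [/eqP/trivial_step //|].
  (* Left border: [s] and its inverse send [x] to the upper half, which lies above all inner
     values. *)
  have lt_x : x < uphalf a.
    move: eq_ij (ltn_ord y) => /=.
    by case: (ltnP _ (uphalf a)) => ?; lia.
  have := osc_s x; have := osc_sV x; rewrite /= [uphalf a <= x]leqNgt lt_x
    => lt_sV lt_s.
  rewrite lt_sV lt_s /=; have := ltn_ord (t y); have := ltn_ord (t^-1%g y).
  by lia.
- move/eqP; rewrite coxeter_length_conj // iprodV !(iprodEl, iprodEr).
  case/orP=> [/eqP/trivial_step //|].
  (* Right border: [s] and its inverse send [y] to the lower half, which lies below all inner
     values. *)
  have ge_y : uphalf a <= y.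
    by move: eq_ij => /=; case: (ltnP _ (uphalf a)) => ?; lia.
  have := osc_s y; have := osc_sV y; rewrite /= ge_y => lt_sV lt_s.
  by rewrite lt_sV lt_s; lia.
- rewrite iprod_conjr => eq_len.
  have eq_y : y = x.+1 :> nat by move: eq_ij => /=; lia.
  move/eqP: eq_len; rewrite coxeter_length_iprod_conjr // => /eqP eq_len.
  exists s, (tperm x y * t * tperm x y); split=> //.
  + exact: coxeter_equiv_refl.
  + exact: coxeter_equiv_conj.
Qed.

(** Forward, each length-preserving step acts on one factor or is trivial. Backward, [s] is moved
    first, while it is known to oscillate; moving [t] afterwards works for any first factor. *)
Lemma coxeter_equiv_iprod s t w : ~~ odd a -> oscillating s ->
  coxeter_equiv (iprod s t) w <->
  exists s' t', [/\ coxeter_equiv s s', coxeter_equiv t t' & w = iprod s' t'].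
Proof.
move=> even_a osc_s; split=> [equiv_w|]; last first.
  case=> s' [t' [equiv_s equiv_t ->]].
  exact: coxeter_equiv_trans (iprod_equivl t osc_s equiv_s)
    (iprod_equivr _ equiv_t).
pose Q v := exists s' t', [/\ oscillating s', coxeter_equiv s s',
  coxeter_equiv t t' & v = iprod s' t'].
suff [s' [t' [_ ? ? ?]]] : Q w by exists s', t'.
have: Q (iprod s t) by exists s, t; split=> //; apply: coxeter_equiv_refl.
move: equiv_w; apply: (coxeter_equiv_ind (P := Q)).
move=> v i j eq_j eq_len [s1 [t1 [osc_s1 equiv_s1 equiv_t1 eq_v]]].
move: eq_len; rewrite {v}eq_v.
case/(oscillating_iprod_conj even_a eq_j osc_s1) => s2 [t2 [? s12 t12 ?]].
exists s2, t2; split=> //.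
  exact: coxeter_equiv_trans equiv_s1 s12.
exact: coxeter_equiv_trans equiv_t1 t12.
Qed.

End EvenInductiveProduct.

(** * Stair forms and their factorization *)

Section Stair.

Lemma size_stair_list n : size (stair_list n) = n.
Proof. by rewrite size_map size_enum_ord. Qed.

Lemma val_stair_list n : map val (stair_list n) = map (stair_val n) (iota 0 n).
Proof. by rewrite -val_enum_ord -!map_comp. Qed.

Lemma stair_list_uniq n : uniq (stair_list n).
Proof.
rewrite -(map_inj_uniq val_inj) val_stair_list map_inj_in_uniq ?iota_uniq //.
move=> p q; rewrite !mem_iota /stair_val.
by case: ifP => ?; case: ifP => ?; lia.
Qed.

Lemma mem_stair_list n i : i \in stair_list n.
Proof.
have sub_enum : {subset stair_list n <= enum 'I_n} by move=> x; rewrite mem_enum.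
have [|_ ->] := uniq_min_size (stair_list_uniq n) sub_enum; last exact: mem_enum.
by rewrite size_stair_list size_enum_ord.
Qed.

(** The first [a] entries alternate between the two ends and, [a] being even, use up [a / 2] values
    at each, which are the outer ones. The next entry is again taken from the low end, so the stair
    list of the inner block follows. *)
Lemma stair_list_iprod a m : ~~ odd a ->
  stair_list (a + m) = map (@iprod_shiftl a m) (stair_list a) ++
                       map (@iprod_shiftr a m) (stair_list m).
Proof.
move=> even_a; apply: (inj_map val_inj).
rewrite map_cat val_stair_list iotaD map_cat add0n -[in iota a m](addn0 a) iotaDl.
congr (_ ++ _).
  transitivity [seq if x < uphalf a then x else x + m | x <- map val (stair_list a)].
    rewrite val_stair_list -map_comp; apply/eq_in_map => p.
    rewrite mem_iota /= /stair_val; case: ifP => odd_p ltp;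
      by case: (ltnP _ (uphalf a)) => ?; lia.
  by rewrite -!map_comp; apply: eq_map.
transitivity [seq x + uphalf a | x <- map val (stair_list m)].
  rewrite val_stair_list -!map_comp; apply/eq_in_map => p.
  rewrite mem_iota /= /stair_val oddD (negPf even_a) /=.
  by case: ifP => odd_p ltp; lia.
by rewrite -!map_comp; apply: eq_map.
Qed.

Lemma stair_perm_iprod a m alpha : ~~ odd a ->
  stair_perm (a + m) (a :: alpha) =
    iprod (stair_perm a [:: a]) (stair_perm m alpha).
Proof.
move=> even_a; rewrite /stair_perm iprod_perm_of_cycles stair_list_iprod //=.
have size_l : size (map (@iprod_shiftl a m) (stair_list a)) = a.
  by rewrite size_map size_stair_list.
rewrite take_size_cat // drop_size_cat // map_reshape take_oversize //.
by rewrite size_stair_list.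
Qed.

(** The stair list alternates between the lower and the upper half, and since [a] is even this stays
    true cyclically, from the last entry back to the first. *)
Lemma stair_perm_oscillating a : ~~ odd a -> oscillating (stair_perm a [:: a]).
Proof.
move=> even_a i; rewrite /stair_perm /= take_oversize ?size_stair_list //.
rewrite perm_of_cycles_cons permM (perm_of_cycles_out (cs := [::])) //.
rewrite cycle_permE undup_id ?stair_list_uniq //.
pose e (x y : nat) := (y < uphalf a) == (uphalf a <= x).
suff: path.cycle e (map val (stair_list a)).
  by rewrite cycle_map => /next_cycle/(_ (mem_stair_list i))/eqP.
rewrite val_stair_list (cycle_path 0).
apply/(pathP 0) => p; rewrite size_map size_iota => lt_p.
rewrite (nth_map 0) ?size_iota // nth_iota // add0n.
case: p lt_p => [|p] lt_p /=.
  (* At index 0 the predecessor is the last entry, at the odd index [a.-1], hence in the upper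
     half. *)
  rewrite -nth_last size_map size_iota (nth_map 0) ?size_iota ?ltn_predL //.
  rewrite nth_iota ?ltn_predL // add0n /e /stair_val /=.
  by case: ifP => ?; lia.
rewrite (nth_map 0) ?size_iota 1?ltnW // nth_iota 1?ltnW // add0n /e /stair_val.
by case: ifP => ?; case: ifP => ?; lia.
Qed.

End Stair.

(** * Iterated products over the even parts *)

Lemma mem_Sigma_cons a alpha (w : 'S_(a + sumn alpha)) : ~~ odd a ->
  w \in Sigma (a + sumn alpha) (a :: alpha) <->
  exists s t, [/\ s \in Sigma a [:: a], t \in Sigma (sumn alpha) alpha
                & w = iprod s t].
Proof.
move=> even_a; rewrite inE stair_perm_iprod //.
rewrite coxeter_equiv_iprod //; last exact: stair_perm_oscillating.
by split=> -[s [t [hs ht ->]]]; exists s, t; rewrite ?inE in hs ht *.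
Qed.

(** Prepends an element to a dependent family. Matching on the ordinal lets [F i] compute in each
    branch, so factors of different degrees need no cast. *)
Definition ord_cons (F : nat -> Type) j (x : F 0)
    (f : forall i : 'I_j, F i.+1) (i : 'I_j.+1) : F i :=
  match i with
  | Ordinal 0 _ => x
  | Ordinal i'.+1 lt_i => f (Ordinal (lt_i : i' < j))
  end.

Lemma ord_cons_lift F j x f (i : 'I_j) :
  @ord_cons F j x f (lift ord0 i) = f i.
Proof.
by case: i => i lt_i /=; congr (f (Ordinal _)); apply: bool_irrelevance.
Qed.

Lemma map_enum_ordSl T j (f : 'I_j.+1 -> T) :
  map f (enum 'I_j.+1) = f ord0 :: [seq f (lift ord0 i) | i <- enum 'I_j].
Proof. by rewrite enum_ordSl map_cons -map_comp. Qed.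

(** Quantifying over a bundled [u] lets the induction on [j] peel off the head of [alpha] by
    [mem_Sigma_cons] although the degree changes. *)
Lemma sized_Sigma_foldr alpha j (u : sized_perm) :
  j <= size alpha -> all (fun a => ~~ odd a) (take j alpha) ->
  tag u = sumn alpha /\ tagged u \in Sigma (tag u) alpha <->
  exists (s : forall i : 'I_j, 'S_(nth 0 alpha i))
         (tau : 'S_(sumn (drop j alpha))),
    [/\ forall i : 'I_j, s i \in Sigma (nth 0 alpha i) [:: nth 0 alpha i],
        tau \in Sigma (sumn (drop j alpha)) (drop j alpha)
      & u = foldr sized_iprod (sized tau) [seq sized (s i) | i <- enum 'I_j]].
Proof.
elim: j alpha u => [|j IH] alpha u.
  move=> _ _; rewrite drop0 (_ : enum 'I_0 = [::]); last first.
    by apply: size0nil; rewrite size_enum_ord.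
  split=> [[]|[s [tau [_ tauS ->]]] //].
  case: u => n w /= eq_n; move: w; rewrite eq_n => w wS.
  have s (i : 'I_0) : 'S_(nth 0 alpha i) by case: i.
  by exists s, w; split=> // -[].
case: alpha => [|a alpha] //= lt_j /andP[even_a even_alpha].
split=> [[]|].
  case: u => n w /= eq_n; move: w; rewrite eq_n => w.
  case/(mem_Sigma_cons _ even_a) => s0 [t [s0S tS ->]].
  have [[//|s [tau [sS tauS eq_t]]] _] := IH alpha (sized t) lt_j even_alpha.
  exists (@ord_cons (fun i => 'S_(nth 0 (a :: alpha) i)) j s0 s), tau.
  split=> //.
    by case=> -[|i] lt_i //=; exact: (sS (Ordinal (lt_i : i < j))).
  transitivity (sized_iprod (sized s0) (sized t)); first by [].
  rewrite map_enum_ordSl eq_t; congr (sized_iprod _ (foldr _ _ _)).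
  by apply: eq_map => i;
    apply: (congr1 (@sized _) (esym (ord_cons_lift s0 s i))).
case=> s [tau [sS tauS ->]]; rewrite map_enum_ordSl /=.
(* [u'] is the product without its first factor; the induction hypothesis gives both its degree and
   its class. *)
pose u' := foldr sized_iprod (sized tau)
  [seq sized (s (lift ord0 i)) | i <- enum 'I_j].
have [_ [|]] := IH alpha u' lt_j even_alpha.
  exists (fun i => s (lift ord0 i)), tau; split=> // i; exact: sS (lift ord0 i).
rewrite -/u'; case: u' => n t /= eq_n; move: t; rewrite eq_n => t tS.
split=> //; apply/mem_Sigma_cons => //.
by exists (s ord0), t; split=> //; apply: sS ord0.
Qed.

Theorem corollary4p57 (n : nat) (alpha : seq nat) (sigma : 'S_n) (j : nat)
    (halpha : maximal_composition n alpha)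
    (htype : perm_eq (cycle_type sigma) alpha)
    (hj : j <= size alpha)
    (heven : all (fun a => ~~ odd a) (take j alpha))
    (hodd : all odd (drop j alpha)) :
  sigma \in Sigma n alpha <->
  exists (s : forall i : 'I_j, 'S_(nth 0 alpha i))
         (tau : 'S_(sumn (drop j alpha))),
    [/\ forall i : 'I_j, s i \in Sigma (nth 0 alpha i) [:: nth 0 alpha i],
        tau \in Sigma (sumn (drop j alpha)) (drop j alpha)
      & sized sigma =
        foldr sized_iprod (sized tau) [seq sized (s i) | i <- enum 'I_j]].
Proof.
rewrite -(sized_Sigma_foldr (sized sigma) hj heven) /=.
(* The parts of [alpha] sum to [n], which is the degree condition on [sized sigma]. *)
by case: halpha => -[_ ->] _; split=> [|[]].
Qed.
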